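(* Let $\alpha\ge 2$ be an integer, and let $T$ be an $r$-regular $3$-partite tournament in which every partite set has cardinality $\alpha$. Then every arc of $T$ belongs to at least $\alpha$ cycles of pairwise distinct lengths. Moreover, this bound is tight: for every integer $\alpha\ge 2$ there exist a regular $3$-partite tournament with all partite sets of cardinality $\alpha$ and an arc of it such that the set of lengths of cycles containing that arc has exactly $\alpha$ elements.
   Context: A $3$-partite tournament is an orientation of a complete $3$-partite graph (finite, with three nonempty partite sets): between any two vertices in different partite sets there is exactly one arc, and there are no arcs within a partite set. A digraph is $r$-regular if $d^+(v)=d^-(v)=r$ for every vertex $v$, and regular if it is $r$-regular for some $r$; here necessarily $r=\alpha$. Cycles are directed and simple; the length of a cycle is its number of arcs. *)

(* Defs.v *)
From mathcomp Require Import all_boot.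

Set Implicit Arguments.
Unset Strict Implicit.
Unset Printing Implicit Defensive.

(* The digraph on [V] has an arc from [x] to [y] iff [e x y]; the partite sets
   are the fibres of [c]. *)
Definition partite_set (V : finType) (c : V -> 'I_3) (i : 'I_3) : {set V} :=
  [set x | c x == i].

Definition tripartite_tournament
    (V : finType) (e : rel V) (c : V -> 'I_3) : Prop :=
  [/\ forall i, partite_set c i != set0,
      forall x y, c x = c y -> ~~ e x y
    & forall x y, c x != c y -> e x y (+) e y x].

Definition outdeg (V : finType) (e : rel V) (v : V) : nat := #|[set w | e v w]|.
Definition indeg (V : finType) (e : rel V) (v : V) : nat := #|[set w | e w v]|.

Definition regular_digraph (V : finType) (e : rel V) (r : nat) : Prop :=
  forall v, outdeg e v = r /\ indeg e v = r.

(* A directed cycle is given by its list of distinct vertices, so its number of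
   arcs is the size of the list. Membership of [u] excludes the empty list,
   which satisfies [ucycleb]. *)
Definition cycle_through_arc
    (V : finType) (e : rel V) (u v : V) (s : seq V) : bool :=
  [&& ucycleb e s, u \in s & next s u == v].

(* A simple cycle has at most #|V| vertices, so the bound on the index loses no
   length. *)
Definition arc_cycle_lengths
    (V : finType) (e : rel V) (u v : V) : {set 'I_#|V|.+1} :=
  [set k : 'I_#|V|.+1 | [exists s : k.-tuple V, cycle_through_arc e u v s]].

(* Main.v *)
Require Import Defs.
From mathcomp Require Import all_boot.
From mathcomp Require Import zify.

(** Degrees force regularity of degree [alpha].  Fix an arc [u -> v] and a
    longest path [R = r_0 ... r_m] of [T - v] ending at [u].  If
    [v -> q_1 -> ... -> q_k = w] is a path that avoids [R], then every
    out-neighbour [r_i] of [w] closes the cycle [v q_1 ... q_k r_i ... r_m],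
    and different [i] give different lengths ([chord]).  So it is enough to
    find such a [w] having [alpha] out-neighbours on [R].  Assume that there
    are fewer than [alpha] lengths, and call the vertices outside [R] and [v]
    uncovered.

    Maximality of [R] says that no uncovered path can be put in front of [R] or
    between [r_i] and [r_(i+1)], nor, when [r_i -> r_0], between [r_0] and
    [r_(i+1)] in the rotated path [r_1 ... r_i r_0 ... r_(i+1) ... r_m].
    Hence uncovered vertices, if there are any, include a sink, that is, one
    that dominates no uncovered vertex ([exists_sink]): otherwise some nonempty
    uncovered set would send arcs only to itself and to [v], which regularity
    does not allow because [u] dominates all its vertices outside the part of
    [u].  Now [v] has an uncovered out-neighbour [x], as its [alpha]
    out-neighbours are not all on [R].  Since a sink is dominated by all
    uncovered vertices of the other parts, some sink [w] is reached from [v]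
    through at most two uncovered vertices.  It does not have [alpha]
    out-neighbours on [R], so it dominates [v] and exactly [alpha - 1] vertices
    of [R].  These give [alpha - 1] lengths, so there is no other
    length ([sink_lengths]).  This is very rigid: for a path [v -> x -> w],
    [x -> r_i] implies [w -> r_(i+1)], and [v -> r_i] implies [w -> r_(i+2)].
    Together with maximality it determines the out-neighbours of [x] on [R] from
    those of [w], and it forces many out-neighbours on [r_0].  Comparing their
    number with [alpha] gives a contradiction, except in one case
    ([two_step_vtx0], [three_step], [vtx0_part_x]): [v -> x -> w -> v], the vertices [r_0] and [x] are in the
    same part, [v -> r_0], the cycle [v r_0 ... r_m] is a longest one through
    the arc, and [x] dominates every uncovered vertex outside its part.

    Reversing all arcs exchanges [u] and [v] and keeps that longest cycle, so
    there are also uncovered [x'], [w'] with [u -> w' -> x' -> u] and [x']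
    dominated by every uncovered vertex outside its part.  Then [w] is in the
    part of [x'] and [w'] in that of [x]; so [x], [x'], [u], [v] lie in four
    different parts, which is absurd.

    The bound is attained by the blow-up of a directed triangle, where all
    lengths are multiples of 3. *)

Set Implicit Arguments.
Unset Strict Implicit.
Unset Printing Implicit Defensive.

(** * Preliminaries on counting *)

Lemma I3_cover (i j k l : 'I_3) :
  i != j -> i != k -> j != k -> [|| l == i, l == j | l == k].
Proof.
by case: i j k l => [[|[|[|?]]] ?] [[|[|[|?]]] ?] [[|[|[|?]]] ?] [[|[|[|?]]] ?].
Qed.

Lemma sorted_cat_cons (T : Type) (e : rel T) p x s :
  sorted e (p ++ x :: s) = sorted e (rcons p x) && path e x s.
Proof. by case: p => //= a p; rewrite cat_path rcons_path /= andbA. Qed.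

(** Sets of positions on a path of [n] vertices are predicates on [nat], so that
    passing to predecessors is the shift [fun i => P i.+1]. *)
Section Counting.
Variable n : nat.
Implicit Types P Q S : pred nat.

Definition cnt P := count P (iota 0 n).

Lemma cnt_sub P Q : (forall i, P i -> Q i) -> cnt P <= cnt Q.
Proof. by move=> PQ; apply: sub_count. Qed.

Lemma cnt_disjoint P Q S :
  (forall i, P i -> S i) -> (forall i, Q i -> S i) ->
  (forall i, P i -> Q i -> False) -> cnt P + cnt Q <= cnt S.
Proof.
move=> PS QS PQ; rewrite -count_predUI.
have -> : count (predI P Q) (iota 0 n) = 0.
  by rewrite (@eq_count _ _ pred0) ?count_pred0 // => i; apply/andP => -[/PQ].
by rewrite addn0; apply: sub_count => i /orP[/PS|/QS].
Qed.

Lemma cnt_split P Q :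
  cnt P = cnt (fun i => P i && Q i) + cnt (fun i => P i && ~~ Q i).
Proof.
rewrite {1}/cnt -size_filter -(count_predC Q) !count_filter.
by congr (_ + _); apply: eq_count => i /=; rewrite andbC.
Qed.

Lemma cnt_shift P : cnt (fun i => P i.+1) + P 0 = cnt P + P n.
Proof.
have <- : count P (iota 0 n.+1) = cnt P + P n.
  by rewrite -addn1 iotaD count_cat /= addn0.
by rewrite /= addnC -[1]addn0 iotaDl count_map.
Qed.

Lemma cnt_shift_eq P : P 0 = false -> P n = false -> cnt (fun i => P i.+1) = cnt P.
Proof. by move=> P0 Pn; have := cnt_shift P; rewrite P0 Pn !addn0. Qed.

Lemma cnt_shift_le P : P n = false -> cnt (fun i => P i.+1) <= cnt P.
Proof. by move=> Pn; have := cnt_shift P; rewrite Pn; lia. Qed.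

Lemma cnt_gt0 P i : i < n -> P i -> 0 < cnt P.
Proof.
by move=> lin Pi; rewrite -has_count; apply/hasP; exists i; rewrite // mem_iota.
Qed.

Lemma cnt_ord P : cnt P = #|[set i : 'I_n | P i]|.
Proof. by rewrite cardsE cardE size_filter /cnt -val_enum_ord count_map enumT. Qed.

End Counting.

(** * Paths ending at the tail of an arc *)

(** The goals are linear in cardinalities and counts, which are treated as
    unknown natural numbers. *)
Ltac arith :=
  repeat match goal with
  | H : is_true (leq _ _) |- _ => revert H
  | H : @eq nat _ _ |- _ => revert H
  end; clear;
  repeat match goal with
  | |- context [card ?A] => let k := fresh in set k := card A; clearbody k
  | |- context [cnt ?m ?P] => let k := fresh in set k := cnt m P; clearbody k
  | |- context [count ?P ?s] => let k := fresh in set k := count P s; clearbody k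
  end; lia.

Section Tournament.
Variables (V : finType) (e : rel V) (c : V -> 'I_3) (alpha : nat).
Hypothesis tour : tripartite_tournament e c.
Hypothesis reg : regular_digraph e alpha.

Lemma arc_color x y : e x y -> c x != c y.
Proof. by case: tour => _ H _ exy; apply/eqP => /H; rewrite exy. Qed.

Lemma arc_asym x y : e x y -> e y x = false.
Proof.
move=> exy; case: tour => _ _ /(_ x y (arc_color exy)).
by rewrite exy; case: (e y x).
Qed.

Lemma arc_irrefl x : e x x = false.
Proof. by apply/negP => /arc_color; rewrite eqxx. Qed.

Lemma arc_total x y : c x != c y -> e x y = false -> e y x.
Proof. by case: tour => _ _ H /H + exy; rewrite exy. Qed.

Lemma card_out x : #|[set y | e x y]| = alpha.
Proof. by case: (reg x). Qed.

Lemma card_in x : #|[set y | e y x]| = alpha.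
Proof. by case: (reg x). Qed.

Section Arc.
Variables u v : V.
Hypothesis euv : e u v.

Lemma uv_neq : v != u.
Proof. by apply: contraTneq euv => ->; rewrite arc_irrefl. Qed.

Definition has_length k := [exists s : k.-tuple V, cycle_through_arc e u v s].

Lemma has_lengthW s : cycle_through_arc e u v s -> has_length (size s).
Proof. by move=> sP; apply/existsP; exists (in_tuple s). Qed.

Lemma has_length_bound k : has_length k -> k < #|V|.+1.
Proof.
case/existsP => s /and3P[/andP[_ us] _ _].
by rewrite ltnS -(size_tuple s) -(card_uniqP us) max_card.
Qed.

(** As [u] and [v] differ, the default value in [last] excludes the empty
    sequence. *)
Definition tail_path R := [&& sorted e R, uniq R, v \notin R & last v R == u].

Section Longest.
Variable R : seq V.
Hypothesis tailR : tail_path R.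
Hypothesis maxR : forall R', tail_path R' -> size R' <= size R.

Definition lenR := size R.
Definition vtx i := nth u R i.
Definition rest := [set x | (x \notin R) && (x != v)].
Definition out_rest x := [set y in rest | e x y].
Definition out x i := (i < lenR) && e x (vtx i).
Definition chain q := [&& path e v q, uniq q & all (mem rest) q].

Lemma lenR_gt0 : 0 < lenR.
Proof.
case/and4P: tailR => _ _ _; rewrite /lenR; case: R => //= /eqP E.
by move: uv_neq; rewrite E eqxx.
Qed.

Lemma R_sorted : sorted e R. Proof. by case/and4P: tailR. Qed.
Lemma R_uniq : uniq R. Proof. by case/and4P: tailR. Qed.
Lemma R_v : v \notin R. Proof. by case/and4P: tailR. Qed.
Lemma R_last : last v R = u. Proof. by case/and4P: tailR => _ _ _ /eqP. Qed.

Lemma vtx_last : vtx lenR.-1 = u.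
Proof. by rewrite /vtx nth_last; case: R R_last. Qed.

Lemma vtx_arc i : i.+1 < lenR -> e (vtx i) (vtx i.+1).
Proof. by move=> lin; move/(sortedP u): R_sorted; apply. Qed.

(** The cycle [v :: q ++ drop i R], which returns to [v] by the arc [u -> v]. *)
Lemma chord q i : chain q -> out (last v q) i -> has_length (size q + 1 + (lenR - i)).
Proof.
case/and3P=> pq uq qX /andP[lin ewr].
have E : drop i R = vtx i :: drop i.+1 R by rewrite (drop_nth u).
have lastE : last (vtx i) (drop i.+1 R) = u.
  rewrite -[LHS]/(last v (vtx i :: drop i.+1 R)) -E -[RHS]R_last.
  by rewrite -{2}(cat_take_drop i R) last_cat E.
have us : uniq (v :: q ++ drop i R).
  rewrite /= mem_cat cat_uniq uq drop_uniq ?R_uniq // andbT /=.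
  apply/andP; split.
    rewrite negb_or; apply/andP; split.
      by apply: contraL qX => vq; apply/allPn; exists v => //=; rewrite !inE eqxx andbF.
    by apply: contra R_v => /mem_drop.
  apply/hasPn => x /mem_drop xR; apply: contraL qX => xq.
  by apply/allPn; exists x => //=; rewrite !inE xR.
have -> : size q + 1 + (lenR - i) = size (v :: q ++ drop i R).
  by rewrite /= size_cat size_drop /lenR; arith.
have lastE' : last v (q ++ drop i R) = u by rewrite last_cat E.
apply: has_lengthW; apply/and3P; split.
- rewrite /ucycleb us andbT /cycle rcons_cat cat_path pq E rcons_cons /= ewr.
  rewrite rcons_path lastE euv andbT.
  have : sorted e (drop i R) by rewrite drop_sorted // R_sorted.
  by rewrite E.
- by rewrite -{1}lastE' mem_last.
- rewrite next_nth -{1}lastE' mem_last -{1}lastE' index_last //.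
  by rewrite nth_default.
Qed.

(** The truncation [inord] is harmless since lengths of cycles are at most
    [#|V|]. *)
Definition chord_lengths (q : seq V) : {set 'I_#|V|.+1} :=
  [set inord (size q + 1 + (lenR - i))
     | i : 'I_lenR in [set i : 'I_lenR | out (last v q) i]].

Lemma chord_lengthsP q : chain q ->
  (chord_lengths q \subset arc_cycle_lengths e u v) &&
  (#|chord_lengths q| == cnt lenR (out (last v q))).
Proof.
move=> cq; apply/andP; split.
  apply/subsetP => k /imsetP[i /[!inE] oi ->].
  by rewrite inordK ?(has_length_bound (chord cq oi)) //; apply: chord.
rewrite cnt_ord card_in_imset // => i j; rewrite !inE => oi oj /(congr1 val) /=.
rewrite !inordK ?(has_length_bound (chord cq oi)) //
  ?(has_length_bound (chord cq oj)) // => E.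
by apply: val_inj => /=; have := ltn_ord i; have := ltn_ord j; arith.
Qed.

Lemma chords_le q : chain q -> cnt lenR (out (last v q)) <= #|arc_cycle_lengths e u v|.
Proof. by move=> /chord_lengthsP/andP[/subset_leq_card + /eqP <-]. Qed.

(** If the end of one chain already accounts for as many lengths as there are,
    then each length comes from one of its out-neighbours. *)
Lemma chords_all q : chain q ->
  #|arc_cycle_lengths e u v| <= cnt lenR (out (last v q)) ->
  forall k, has_length k -> exists2 i, out (last v q) i & k + i = size q + 1 + lenR.
Proof.
move=> cq; have /andP[sub /eqP E] := chord_lengthsP cq; rewrite -E => le k hk.
have /eqP EL : chord_lengths q == arc_cycle_lengths e u v by rewrite eqEcard sub.
have : inord k \in arc_cycle_lengths e u v by rewrite inE inordK ?has_length_bound.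
rewrite -EL => /imsetP[i]; rewrite inE => oi /(congr1 val) /=.
rewrite !inordK ?(has_length_bound (chord cq oi)) ?has_length_bound // => ->.
by exists (val i) => //=; have := ltn_ord i; arith.
Qed.

Lemma cnt_out x : cnt lenR (out x) = count (e x) R.
Proof.
rewrite -[in RHS](mkseq_nth u R) count_map; apply: eq_in_count => i.
by rewrite mem_iota add0n /out => /andP[_ ->].
Qed.

Lemma cnt_R (f : V -> bool) : cnt lenR (fun i => f (vtx i)) = #|[set z in R | f z]|.
Proof.
have -> : cnt lenR (fun i => f (vtx i)) = count f R.
  by rewrite -[in RHS](mkseq_nth u R) count_map.
rewrite -size_filter -(card_uniqP (filter_uniq f R_uniq)).
by apply: eq_card => z; rewrite !inE mem_filter andbC.
Qed.

Lemma outdeg_split x : cnt lenR (out x) + #|out_rest x| + e x v = alpha.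
Proof.
rewrite -(card_out x) cnt_out -size_filter.
rewrite -(card_uniqP (filter_uniq (e x) R_uniq)) -addnA.
have -> : [set y | e x y] = [set y in R | e x y] :|: [set y | (y \notin R) && e x y].
  by apply/setP => y; rewrite !inE; case: (y \in R); rewrite ?orbF.
rewrite cardsU disjoint_setI0 ?cards0 ?subn0; last first.
  by rewrite disjoint_subset; apply/subsetP => y; rewrite !inE => /andP[->].
congr (_ + _); first by apply: eq_card => y; rewrite !inE mem_filter andbC.
rewrite (cardsD1 v [set y | (y \notin R) && e x y]) inE R_v addnC; congr (_ + _).
by apply: eq_card => y; rewrite !inE; case: (y == v); rewrite ?andbT ?andbF.
Qed.

(** Common form of the consequences of maximality: the vertices of [q] cannot be
    absorbed. *)
Lemma no_longer q R' : perm_eq R' (q ++ R) -> uniq q -> all (mem rest) q ->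
  sorted e R' -> last v R' = u -> q = [::].
Proof.
move=> pR uq qX sR lR; have : tail_path R'.
  apply/and4P; split=> //; last exact/eqP.
    rewrite (perm_uniq pR) cat_uniq uq R_uniq andbT; apply/hasPn => x xR.
    by apply: contraL qX => xq; apply/allPn; exists x => //=; rewrite !inE xR.
  rewrite (perm_mem pR) mem_cat negb_or R_v andbT.
  by apply: contraL qX => vq; apply/allPn; exists v => //=; rewrite !inE eqxx andbF.
move/maxR; rewrite (perm_size pR) size_cat -[X in _ <= X]add0n leq_add2r leqn0.
by move/nilP.
Qed.

Lemma R_split i : i.+1 < lenR -> R = take i R ++ vtx i :: vtx i.+1 :: drop i.+2 R.
Proof.
by move=> lin; rewrite -(drop_nth u lin) -(drop_nth u (ltnW lin)) cat_take_drop.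
Qed.

Lemma R_head : R = vtx 0 :: behead R.
Proof. by rewrite /vtx; move: lenR_gt0; rewrite /lenR; case: R. Qed.

Lemma no_extend x : x \in rest -> e x (vtx 0) = false.
Proof.
move=> xX; apply/negP => ex0.
suff : [:: x] = [::] by [].
apply: (@no_longer _ (x :: R)) => //=; first by rewrite xX.
- have := R_sorted; rewrite [X in sorted _ X]R_head /= => pR.
  by rewrite [X in path _ _ X]R_head /= ex0.
- by have := R_last; rewrite R_head.
Qed.

Lemma no_insert i a q : i.+1 < lenR -> uniq (a :: q) -> all (mem rest) (a :: q) ->
  path e (vtx i) (a :: q) -> e (last a q) (vtx i.+1) = false.
Proof.
move=> lin uq qX pq; apply/negP => eq1.
suff : a :: q = [::] by [].
have E := R_split lin.
apply: (@no_longer _ (take i R ++ vtx i :: (a :: q) ++ vtx i.+1 :: drop i.+2 R)) => //.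
- rewrite [X in perm_eq _ (_ ++ X)]E; apply/permP => f.
  by rewrite /= !count_cat /= !count_cat /=; arith.
- have := R_sorted; rewrite {1}E !sorted_cat_cons => /andP[-> /=].
  by move: pq eq1 => /= /andP[-> pq] eq1 /andP[_ p2]; rewrite cat_path pq /= eq1.
- by have := R_last; rewrite {1}E !last_cat /= last_cat.
Qed.

(** The arc from [vtx i] to [vtx 0] allows the path to start at [vtx 1], to go
    round to [vtx 0], and to take [a :: q] on its way to [vtx i.+1]. *)
Lemma no_rotate i a q : i.+1 < lenR -> e (vtx i) (vtx 0) ->
  uniq (a :: q) -> all (mem rest) (a :: q) ->
  path e (vtx 0) (a :: q) -> e (last a q) (vtx i.+1) = false.
Proof.
move=> lin ei0 uq qX pq; apply/negP => eq1.
suff : a :: q = [::] by [].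
have i0 : 0 < i by case: i ei0 {lin eq1} => //; rewrite arc_irrefl.
have E := R_split lin.
have Et : take i R = vtx 0 :: take i.-1 (behead R).
  by case: (i) i0 => // j _; rewrite [X in take _ X]R_head.
set p := take i.-1 _ in Et.
apply: (@no_longer _ (p ++ vtx i :: vtx 0 :: (a :: q) ++ vtx i.+1 :: drop i.+2 R)) => //.
- rewrite [X in perm_eq _ (_ ++ X)]E Et; apply/permP => f.
  by rewrite /= !count_cat /= !count_cat /=; arith.
- have := R_sorted; rewrite {1}E Et sorted_cat_cons => /andP[pp /= /andP[_ p2]].
  rewrite sorted_cat_cons /= ei0 cat_path (path_sorted pp) /=.
  by move: pq eq1 => /= /andP[-> ->] ->.
- by have := R_last; rewrite {1}E !last_cat /= last_cat.
Qed.

Let in_rest x : (x \in rest) = (x \notin R) && (x != v).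
Proof. by rewrite inE. Qed.

Lemma u_in_R : u \in R.
Proof. by rewrite -vtx_last; apply: mem_nth; have := lenR_gt0; rewrite -/lenR; arith. Qed.

Lemma R_index x : x \in R -> exists2 i, i < lenR & x = vtx i.
Proof. by move=> xR; exists (index x R); rewrite ?index_mem // /vtx nth_index. Qed.

Lemma arc_from_rest z i : i.+1 < lenR -> z \in rest -> e (vtx i) z ->
  e z (vtx i.+1) = false.
Proof.
by move=> lin zX eiz; apply: (@no_insert i z [::]); rewrite //= ?zX ?eiz.
Qed.

(** Take the first vertex of [R], not [vtx 0], that receives an arc from some [z] in [Z].  Its
    predecessor on [R] receives none, so it is in the part of [z] or [z] could be
    inserted; then it dominates any predecessor [y] of [z] in [Z], and [y], [z]
    can be inserted together. *)
Lemma closed_no_arc (Z : {set V}) : Z \subset rest ->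
  (forall z, z \in Z -> exists2 y, y \in Z & e y z) ->
  forall z x, z \in Z -> x \in R -> e z x = false.
Proof.
move=> ZX pred z x zZ /R_index[i lin ->] {x}.
have inX y : y \in Z -> y \in rest by apply: (subsetP ZX).
elim: i z zZ lin => [|i IH] z zZ lin; first by rewrite no_extend ?inX.
have lin' := ltnW lin.
apply/negP => ez; have eiz : e (vtx i) z = false.
  by apply: contraTF ez => eiz; rewrite arc_from_rest ?inX.
have [y yZ eyz] := pred z zZ.
have cz : c z = c (vtx i).
  apply/eqP; apply: contraFT (IH z zZ lin') => cz.
  by apply: arc_total eiz; rewrite eq_sym.
have eiy : e (vtx i) y.
  apply: arc_total (IH y yZ lin').
  by rewrite -cz arc_color.
have yz : y != z by apply: contraTneq eyz => ->; rewrite arc_irrefl.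
suff : e z (vtx i.+1) = false by rewrite ez.
apply: (@no_insert i y [:: z] lin); first by rewrite /= inE yz.
  by rewrite /= !inX.
by rewrite /= eiy eyz.
Qed.

(** Without a sink, a minimal nonempty set [Z] closed under out-neighbours
    outside [R] consists of vertices with a predecessor in [Z], and so sends
    arcs only to itself and [v].  By regularity it receives as many arcs from
    outside as it sends to [v], at most [alpha - 1] since [u] is another
    in-neighbour of [v].  But [u] dominates the set [Zu] of vertices of [Z]
    outside its part; hence [Zu] has at most [alpha - 1] vertices, and a vertex
    of [Zu] has too few out-neighbours. *)
Lemma exists_sink : rest != set0 -> exists2 w, w \in rest & out_rest w = set0.
Proof.
move=> X0; case: (pickP [pred w in rest | out_rest w == set0]) => [w /andP[wX /eqP]|noS].
  by exists w.
have nosink z : z \in rest -> out_rest z != set0.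
  by move=> zX; apply: contraFN (noS z) => E; apply/andP.
pose P (Z : {set V}) :=
  [&& Z != set0, Z \subset rest & [forall z in Z, out_rest z \subset Z]].
have PX : P rest.
  by rewrite /P X0 subxx; apply/forall_inP => z _; apply/subsetP => y /setIdP[].
have [Z /minsetP[/and3P[Z0 ZX /forall_inP clZ] minZ] _] := minset_exists PX.
have inX y : y \in Z -> y \in rest by apply: (subsetP ZX).
have pred z : z \in Z -> exists2 y, y \in Z & e y z.
  move=> zZ; case: (pickP [pred y in Z | e y z]) => [y /andP[]|nop].
    by exists y.
  have [y] := set0Pn _ (nosink z (inX z zZ)); rewrite inE => /andP[yX ezy].
  have yZ : y \in Z by apply: (subsetP (clZ z zZ)); rewrite inE yX.
  suff /minZ/(_ (subsetDl _ _)) E : P (Z :\ z) by move: zZ; rewrite -E !inE eqxx.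
  apply/and3P; split.
  - apply/set0Pn; exists y; rewrite !inE yZ andbT.
    by apply: contraTneq ezy => ->; rewrite arc_irrefl.
  - exact: subset_trans (subsetDl _ _) ZX.
  - apply/forall_inP => x /setD1P[xz xZ]; apply/subsetP => t tN; rewrite !inE.
    rewrite (subsetP (clZ x xZ)) // andbT; apply: contraTneq tN => ->.
    by apply: contraFN (nop x) => /setIdP[_ exz]; apply/andP.
have noarc := closed_no_arc ZX pred.
pose N z := [set y in Z | e z y].
have out_Z z : z \in Z -> #|N z| + e z v = alpha.
  move=> zZ; rewrite -(outdeg_split z).
  have -> : N z = out_rest z.
    apply/setP => y; rewrite [LHS]inE [RHS]inE.
    case ezy: (e z y); rewrite ?andbF // !andbT.
    apply/idP/idP => [/inX//|yX]; apply: (subsetP (clZ z zZ)).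
    by rewrite [_ \in _]inE yX.
  suff -> : cnt lenR (out z) = 0 by [].
  rewrite cnt_out; apply/eqP; rewrite -leqn0 leqNgt -has_count.
  by apply/hasPn => x xR; rewrite noarc.
have uZ z : z \in Z -> c z != c u -> e u z.
  by move=> zZ cz; apply: (arc_total cz); rewrite noarc ?u_in_R.
pose Zu := [set z in Z | c z != c u].
have sumZ : \sum_(z in Z) #|N z| = \sum_(z in Z) #|[set y in Z | e y z]|.
  have E (f : rel V) : \sum_(z in Z) #|[set y in Z | f z y]| =
      \sum_(z in Z) \sum_(y in Z) f z y.
    apply: eq_bigr => z _; rewrite -sum1_card big_mkcond [RHS]big_mkcond.
    by apply: eq_bigr => y _; rewrite inE; case: (y \in Z); case: (f z y).
  by rewrite !E exchange_big.
have in_Z z : z \in Z -> #|[set y in Z | e y z]| + (z \in Zu) <= alpha.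
  move=> zZ; rewrite -(card_in z) (cardsD1 u [set y | e y z]) addnC inE leq_add //.
    by rewrite inE zZ /=; case: (boolP (c z != c u)) => // /(uZ z zZ) ->.
  apply: subset_leq_card; apply/subsetP => y; rewrite !inE => /andP[yZ ->].
  by rewrite andbT; apply: contraTneq (inX y yZ) => ->; rewrite in_rest u_in_R.
pose Zv := [set z in Z | e z v].
have ZuZv : #|Zu| <= #|Zv|.
  have card_sum (f : V -> bool) : \sum_(z in Z) (f z : nat) = #|[set z in Z | f z]|.
    rewrite -sum1_card big_mkcond [RHS]big_mkcond; apply: eq_bigr => z _.
    by rewrite inE; case: (z \in Z); case: (f z).
  have E1 : \sum_(z in Z) #|N z| + #|Zv| = \sum_(z in Z) alpha.
    by rewrite -card_sum -big_split; apply: eq_bigr => z /out_Z.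
  have E2 : \sum_(z in Z) #|N z| + #|Zu| <= \sum_(z in Z) alpha.
    have -> : Zu = [set z in Z | z \in Zu].
      by apply/setP => z; rewrite !inE; case: (z \in Z).
    by rewrite sumZ -card_sum -big_split; apply: leq_sum => z /in_Z.
  by rewrite -E1 leq_add2l in E2.
have Zv_small : #|Zv| < alpha.
  rewrite -(card_in v) (cardsD1 u [set y | e y v]) inE euv ltnS.
  apply: subset_leq_card; apply/subsetP => y; rewrite !inE => /andP[yZ ->].
  by rewrite andbT; apply: contraTneq (inX y yZ) => ->; rewrite in_rest u_in_R.
have [z' z'Zu] : exists z, z \in Zu.
  have [z zZ] := set0Pn _ Z0; have [E|NE] := eqVneq (c z) (c u); last first.
    by exists z; rewrite inE zZ.
  have [y yZ eyz] := pred z zZ.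
  by exists y; rewrite inE yZ -E arc_color.
have z'Z : z' \in Z by move: z'Zu; rewrite inE => /andP[].
have sub : N z' \subset Zu :\ z'.
  apply/subsetP => y /setIdP[yZ ez'y]; rewrite !inE yZ.
  rewrite [y != z'](_ : _ = true); last first.
    by apply: contraTneq ez'y => ->; rewrite arc_irrefl.
  (* a vertex [y] of [Z] in the part of [u] would have to dominate all of [Zu] *)
  apply/eqP => cy.
  have yN : N y \subset Zu.
    by apply/subsetP => t /setIdP[tZ eyt]; rewrite inE tZ -cy eq_sym arc_color.
  have /eqP EN : N y == Zu.
    by rewrite eqEcard yN; have := out_Z y yZ; case: (e y v); arith.
  by move: z'Zu; rewrite -EN inE (arc_asym ez'y) andbF.
have := subset_leq_card sub; have := out_Z z' z'Z.
by have := cardsD1 z' Zu; rewrite z'Zu; case: (e z' v); arith.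
Qed.

(** * Consequences of having few cycle lengths *)

Definition walk a q := [&& path e a q, uniq (a :: q) & all (mem rest) (a :: q)].

Lemma out_before i a q : walk a q -> out (last a q) i.+1 -> e (vtx i) a = false.
Proof.
case/and3P=> pq uq qX /andP[lin ew]; apply/negP => eia.
by move: ew; rewrite (no_insert lin uq qX) //= eia.
Qed.

Lemma out_before_vtx0 i a q : walk a q -> c a != c (vtx 0) ->
  out (last a q) i.+1 -> e (vtx i) (vtx 0) = false.
Proof.
case/and3P=> pq uq qX ca /andP[lin ew]; apply/negP => ei0.
move: ew; rewrite (no_rotate lin ei0 uq qX) //= pq andbT.
by apply: (arc_total ca); rewrite no_extend //; case/andP: qX.
Qed.

Lemma out0 y : y \in rest -> out y 0 = false.
Proof. by move=> yX; rewrite /out no_extend ?andbF. Qed.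

Lemma out_lenR y : out y lenR = false. Proof. by rewrite /out ltnn. Qed.

Lemma out_lenRS y : out y lenR.+1 = false.
Proof. by rewrite /out ltnNge leqnSn. Qed.

Lemma out_rest_sub y : out_rest y \subset rest.
Proof. by apply/subsetP => z /setIdP[]. Qed.

Lemma to_out y i : i < lenR -> c (vtx i) != c y -> e (vtx i) y = false -> out y i.
Proof. by move=> lin ci e0; rewrite /out lin (arc_total ci e0). Qed.

Lemma out_total y z i : out z i.+1 -> c (vtx i) != c y -> e (vtx i) y = false -> out y i.
Proof. by case/andP=> /ltnW lin _; apply: to_out. Qed.

Lemma vtx0_to_rest y : y \in rest -> c y != c (vtx 0) -> e (vtx 0) y.
Proof. by move=> yX cy; apply: (arc_total cy); rewrite no_extend. Qed.

Lemma card_out_rest_vtx0 (A : {set V}) : A \subset rest ->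
  (forall y, y \in A -> c y != c (vtx 0)) -> #|A| <= #|out_rest (vtx 0)|.
Proof.
move=> AX cA; apply: subset_leq_card; apply/subsetP => y yA.
have yX := subsetP AX y yA.
by apply/setIdP; split=> //; apply: vtx0_to_rest => //; apply: cA.
Qed.

Section Few.
Hypothesis card_part : forall i, #|partite_set c i| = alpha.
Hypothesis alpha_ge2 : 2 <= alpha.
Hypothesis few : #|arc_cycle_lengths e u v| < alpha.

(** Otherwise the [alpha] out-neighbours of the sink are all on [R]. *)
Lemma sink_to_v q : chain q -> out_rest (last v q) = set0 -> e (last v q) v.
Proof.
move=> cq sink; have := chords_le cq; have := outdeg_split (last v q).
by rewrite sink cards0; case: (e _ v) => //; arith.
Qed.

Lemma sink_lengths q : chain q -> out_rest (last v q) = set0 ->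
  forall k, has_length k -> exists2 i, out (last v q) i & k + i = size q + 1 + lenR.
Proof.
move=> cq sink; apply: chords_all => //; have := outdeg_split (last v q).
by rewrite sink cards0; case: (e _ v); arith.
Qed.

(** Both chains close cycles of the same length, and the length determines the
    out-neighbour of the sink that is used. *)
Lemma out_shift q1 q2 d i : chain q1 -> chain q2 -> out_rest (last v q2) = set0 ->
  size q2 = size q1 + d -> out (last v q1) i -> out (last v q2) (i + d).
Proof.
move=> c1 c2 sink sz oi; have [j oj] := sink_lengths c2 sink (chord c1 oi).
move: (oi) (oj) => /andP[lin _] /andP[ljn _] E.
by have -> : i + d = j by arith.
Qed.

(** Two such chains would make the set of positions dominated by the sink closed
    under predecessor, without a least element. *)
Lemma chain_grade q1 q2 : chain q1 -> chain q2 -> last v q1 = last v q2 ->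
  out_rest (last v q2) = set0 -> size q1 = (size q2).+1 -> False.
Proof.
move=> c1 c2 El sink sz; set w := last v q2 in El sink.
have no i : ~~ out w i.
  elim/ltn_ind: i => i IH; apply/negP => oi.
  have := chord c1; rewrite El => /(_ i oi) h.
  have [j oj E] := sink_lengths c2 sink h.
  by move: (oi) (oj) => /andP[lin _] /andP[ljn _]; have := IH j; rewrite oj; arith.
have : cnt lenR (out w) = 0.
  by rewrite /cnt (eq_count (a2 := pred0)) ?count_pred0 // => i; apply/negbTE.
have := outdeg_split w; rewrite sink cards0; case: (e w v); arith.
Qed.

Lemma out_rest_v_neq0 : out_rest v != set0.
Proof.
apply/negP => /eqP E; have := @sink_to_v [::] isT E.
by rewrite arc_irrefl.
Qed.

Lemma to_sink w y : w \in rest -> out_rest w = set0 -> y \in rest -> c y != c w -> e y w.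
Proof.
move=> wX sink yX cy; apply: arc_total; first by rewrite eq_sym.
by apply/negP => ewy; have := in_set0 y; rewrite -sink inE yX ewy.
Qed.

Lemma out_sink_pos w : out_rest w = set0 -> e w v -> cnt lenR (out w) + 1 = alpha.
Proof. by move=> sink ewv; rewrite -(outdeg_split w) sink cards0 ewv addn0. Qed.

(** ** A sink dominated by an out-neighbour of v *)

Section TwoStep.
Variables x w : V.
Hypotheses (xX : x \in rest) (wX : w \in rest) (evx : e v x) (exw : e x w) (ewv : e w v).
Hypothesis sink : out_rest w = set0.

Let x_neq_w : (x == w) = false.
Proof. by apply/eqP => E; move: exw; rewrite E arc_irrefl. Qed.

Lemma chain_x : chain [:: x].
Proof. by rewrite /chain /= evx xX. Qed.

Lemma chain_xw : chain [:: x; w].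
Proof. by rewrite /chain /= evx exw xX wX inE x_neq_w. Qed.

Lemma out_x i : out x i -> out w i.+1.
Proof. by rewrite -addn1; apply: (out_shift chain_x chain_xw). Qed.

Lemma out_v i : out v i -> out w i.+2.
Proof. by rewrite -addn2; apply: (@out_shift [::] _ _ _ isT chain_xw). Qed.

Let walk_w : walk w [::].
Proof. by rewrite /walk /= wX. Qed.

Let walk_x : walk x [::].
Proof. by rewrite /walk /= xX. Qed.

Let walk_xw : walk x [:: w].
Proof. by rewrite /walk /= exw xX wX inE x_neq_w. Qed.

Lemma out_w_x i : out w i.+1 -> c (vtx i) != c x -> out x i.
Proof. by move=> ow ci; apply: (out_total ow ci (out_before walk_xw ow)). Qed.

Lemma out_w_w i : out w i.+1 -> c (vtx i) != c w -> out w i.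
Proof. by move=> ow ci; apply: (out_total ow ci (out_before walk_w ow)). Qed.

(** Such a [y] in another part would dominate [w] and give a chain with one more
    vertex. *)
Lemma out_rest_x_color y : y \in out_rest x -> c y = c w.
Proof.
move=> /setIdP[yX exy]; apply/eqP; apply/negPn/negP => cy.
have eyw := to_sink wX sink yX cy.
apply: (@chain_grade [:: x; y; w] [:: x; w]) => //; last exact: chain_xw.
have xy : (x == y) = false by apply/eqP => E; move: exy; rewrite E arc_irrefl.
have yw : (y == w) = false by apply/eqP => E; move: eyw; rewrite E arc_irrefl.
by rewrite /chain /= evx exy eyw xX yX wX !inE x_neq_w xy yw.
Qed.

(** A [y] in the part of [w] is not a sink, because it does not dominate [v]; it
    reaches [w] in two steps, whereas [x] does in one. *)
Lemma out_rest_v_color y : y \in out_rest v -> c y != c w.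
Proof.
move=> /setIdP[yX evy]; apply/eqP => cy.
have [E|] := eqVneq (out_rest y) set0.
  have := @sink_to_v [:: y]; rewrite /chain /= evy yX => /(_ isT E).
  by rewrite (arc_asym evy).
case/set0Pn => t /setIdP[tX eyt].
have etw : e t w by apply: to_sink => //; rewrite -cy eq_sym arc_color.
apply: (@chain_grade [:: y; t; w] [:: x; w]) => //; last exact: chain_xw.
have yt : (y == t) = false by apply/eqP => E; move: eyt; rewrite E arc_irrefl.
have tw : (t == w) = false by apply/eqP => E; move: etw; rewrite E arc_irrefl.
have yw : (y == w) = false.
  by apply/eqP => E; move: ewv; rewrite -E (arc_asym evy).
by rewrite /chain /= evy eyt etw tX yX wX !inE yt tw yw.
Qed.

(** The positions that precede an out-neighbour of [w] do not dominate [vtx 0],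
    by rotation through [w], or through [x] and [w] if [w] and [vtx 0] are in the
    same part. *)
Lemma out_w_vtx0 i : out w i.+1 -> c (vtx i) != c (vtx 0) -> out (vtx 0) i.
Proof.
move=> ow ci; apply: (out_total ow ci).
have [E|NE] := eqVneq (c w) (c (vtx 0)); last exact: (out_before_vtx0 walk_w NE ow).
by apply: (out_before_vtx0 walk_xw) => //; rewrite -E arc_color.
Qed.

Lemma out_x_vtx0 i : c x != c (vtx 0) -> out x i.+1 -> c (vtx i) != c (vtx 0) ->
  out (vtx 0) i.
Proof.
by move=> cx ox ci; apply: (out_total ox ci (out_before_vtx0 walk_x cx ox)).
Qed.

(** Every out-neighbour of [x] is then an out-neighbour of [vtx 0]; both have
    [alpha] of them, so they are the same, and [v] is not among them. *)
Lemma vtx0_part_x : c (vtx 0) = c x ->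
  [/\ e v (vtx 0), forall k, has_length k -> k <= lenR.+1
    & forall y, y \in rest -> c y != c x -> e x y].
Proof.
move=> c0.
have sub i : out x i -> out (vtx 0) i.
  move=> ox; apply: out_w_vtx0; first exact: out_x.
  by rewrite c0 eq_sym arc_color //; case/andP: ox.
have le := cnt_sub lenR sub.
have NXs : out_rest x \subset out_rest (vtx 0).
  apply/subsetP => y yN; have /setIdP[yX exy] := yN.
  by apply/setIdP; split=> //; apply: vtx0_to_rest; rewrite // c0 eq_sym arc_color.
have le2 := subset_leq_card NXs.
have Ex := outdeg_split x; have E0 := outdeg_split (vtx 0).
rewrite (arc_asym evx) in Ex.
have e0v : e (vtx 0) v = false by case: (e (vtx 0) v) E0 => //; arith.
split.
- by apply: arc_total e0v; rewrite c0 eq_sym arc_color.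
- move=> k hk; have [i] := sink_lengths chain_xw sink hk; rewrite /=.
  case: i => [|[|i]]; rewrite ?(out0 wX) //; last arith.
  move=> ow; have := out_w_w ow; rewrite c0 arc_color // (out0 wX).
  by move=> /(_ isT).
- move=> y yX cy; have : y \in out_rest (vtx 0) by rewrite inE yX vtx0_to_rest // c0.
  have /eqP <- : out_rest x == out_rest (vtx 0) by rewrite eqEcard NXs /=; arith.
  by case/setIdP.
Qed.

(** In the part of [v], [vtx 0] dominates the uncovered out-neighbours of [x] and
    of [v], and the predecessors outside its part of the out-neighbours of [x].
    The out-neighbours of [v] on [R] are at distance two before those of [w] and
    avoid this part, so few predecessors are lost and more than [alpha]
    out-neighbours remain. *)
Lemma vtx0_part_v : c (vtx 0) != c v.
Proof.
apply/eqP => c0.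
have c0x : c x != c (vtx 0) by rewrite c0 eq_sym arc_color.
pose D i := out x i.+1.
have ED : cnt lenR D = cnt lenR (out x).
  by apply: cnt_shift_eq; rewrite ?out0 ?out_lenR.
have b1 : cnt lenR (fun i => D i && (c (vtx i) == c v)) + cnt lenR (out v) <=
    cnt lenR (fun i => out w i.+2).
  apply: cnt_disjoint => i; first by case/andP=> /out_x.
    exact: out_v.
  by case/andP=> _ /eqP E /andP[_ /arc_color]; rewrite E eqxx.
have b2 : cnt lenR (fun i => out w i.+2) <= cnt lenR (out w).
  apply: leq_trans (cnt_shift_le (out_lenR w)).
  exact: (@cnt_shift_le _ (fun i => out w i.+1) (out_lenRS w)).
have b3 := cnt_split lenR D (fun i => c (vtx i) == c v).
have b4 : cnt lenR (fun i => D i && (c (vtx i) != c v)) <= cnt lenR (out (vtx 0)).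
  by apply: cnt_sub => i /andP[Di ci]; apply: (out_x_vtx0 c0x Di); rewrite c0.
have b5 : #|out_rest x| + #|out_rest v| <= #|out_rest (vtx 0)|.
  have <- : #|out_rest x :|: out_rest v| = #|out_rest x| + #|out_rest v|.
    rewrite cardsU disjoint_setI0 ?cards0 ?subn0 //; apply/pred0P => y /=.
    by apply/negP => /andP[/out_rest_x_color E /out_rest_v_color]; rewrite E eqxx.
  apply: card_out_rest_vtx0; first by rewrite subUset !out_rest_sub.
  move=> y /setUP[/out_rest_x_color ->|/setIdP[_ /arc_color]].
    by rewrite c0 arc_color.
  by rewrite c0 eq_sym.
have := outdeg_split x; have := outdeg_split v; have := outdeg_split (vtx 0).
have := out_sink_pos sink ewv; rewrite arc_irrefl (arc_asym evx); arith.
Qed.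

(** Let [D] be the predecessors of the out-neighbours of [w].  In the part of
    [w], [vtx 0] dominates the vertices of [D] outside this part and, by rotation
    through [x], the predecessors of the others: [alpha - 1] vertices of [R],
    besides [x].  Hence [v] dominates [vtx 0], and following
    the implications [v -> vtx 0], [w -> vtx 2], [w -> vtx 1] shows that [x]
    dominates [vtx 0], against maximality. *)
Lemma vtx0_part_w : c (vtx 0) != c w.
Proof.
apply/eqP => c0.
have c0x : c x != c (vtx 0) by rewrite c0 arc_color.
pose D i := out w i.+1.
have Dc i : D i -> c (vtx i) = c w -> out x i.
  by move=> Di ci; apply: out_w_x; rewrite // ci eq_sym arc_color.
have ED : cnt lenR D = cnt lenR (out w).
  by apply: cnt_shift_eq; rewrite ?out0 ?out_lenR.
pose D' i := D i.+1 && (c (vtx i.+1) == c w).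
have ED' : cnt lenR D' = cnt lenR (fun i => D i && (c (vtx i) == c w)).
  apply: (@cnt_shift_eq _ (fun i => D i && (c (vtx i) == c w))).
    by apply/andP => -[/Dc + /eqP E] => /(_ E); rewrite out0.
  by rewrite /D out_lenRS.
have b1 : cnt lenR D' + cnt lenR (fun i => D i && (c (vtx i) != c w)) <=
    cnt lenR (out (vtx 0)).
  apply: cnt_disjoint => i.
  - case/andP=> Di /eqP ci; have ox := Dc _ Di ci; have /andP[lin _] := ox.
    apply: (out_x_vtx0 c0x ox).
    by rewrite c0 -ci arc_color // vtx_arc.
  - by case/andP=> Di ci; apply: out_w_vtx0; rewrite ?c0.
  - case/andP=> _ /eqP ci /andP[/andP[_ /arc_color]].
    by rewrite ci eqxx.
have b2 := cnt_split lenR D (fun i => c (vtx i) == c w).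
have b3 : 0 < #|out_rest (vtx 0)|.
  by apply/card_gt0P; exists x; rewrite inE xX vtx0_to_rest.
have E0 := outdeg_split (vtx 0); have Ew := out_sink_pos sink ewv.
have e0v : e (vtx 0) v = false by case: (e (vtx 0) v) E0 => //; arith.
have ev0 : e v (vtx 0) by apply: arc_total e0v; rewrite c0 arc_color.
have ow2 : out w 2 by apply: out_v; rewrite /out lenR_gt0.
have lin : 1 < lenR by case/andP: ow2 => /ltnW.
have ow1 : out w 1 by apply: out_w_w; rewrite // -c0 eq_sym arc_color // vtx_arc.
by have := Dc 0 ow1 c0; rewrite (out0 xX).
Qed.

Lemma two_step_vtx0 : c (vtx 0) = c x.
Proof.
have := I3_cover (c (vtx 0)) (arc_color evx) _ (arc_color exw).
rewrite (negbTE vtx0_part_v) (negbTE vtx0_part_w) /= orbF => /(_ _)/eqP; apply.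
by rewrite eq_sym arc_color.
Qed.

End TwoStep.
(** ** A sink in the part of an out-neighbour of v *)

Section ThreeStep.
Variables x y w : V.
Hypotheses (xX : x \in rest) (yX : y \in rest) (wX : w \in rest).
Hypotheses (evx : e v x) (exy : e x y) (eyw : e y w) (ewv : e w v).
Hypothesis sink : out_rest w = set0.
Hypothesis cxw : c x = c w.

Let xy : (x == y) = false.
Proof. by apply/eqP => E; move: exy; rewrite E arc_irrefl. Qed.
Let yw : (y == w) = false.
Proof. by apply/eqP => E; move: eyw; rewrite E arc_irrefl. Qed.
Let xw : (x == w) = false.
Proof. by apply/eqP => E; move: evx; rewrite E (arc_asym ewv). Qed.

Let cyw : c y != c w. Proof. exact: arc_color. Qed.

Let chain_3 : chain [:: x; y; w].
Proof. by rewrite /chain /= evx exy eyw xX yX wX !inE xy yw xw. Qed.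
Let chain_2 : chain [:: x; y].
Proof. by rewrite /chain /= evx exy xX yX !inE xy. Qed.
Let chain_1 : chain [:: x].
Proof. by rewrite /chain /= evx xX. Qed.

Let walk_w : walk w [::]. Proof. by rewrite /walk /= wX. Qed.
Let walk_y : walk y [::]. Proof. by rewrite /walk /= yX. Qed.
Let walk_x : walk x [::]. Proof. by rewrite /walk /= xX. Qed.
Let walk_xy : walk x [:: y].
Proof. by rewrite /walk /= exy xX yX !inE xy. Qed.
Let walk_yw : walk y [:: w].
Proof. by rewrite /walk /= eyw yX wX !inE yw. Qed.

Let out_y_w i : out y i -> out w i.+1.
Proof. by rewrite -addn1; apply: (out_shift chain_2 chain_3). Qed.
Let out_x_w i : out x i -> out w i.+2.
Proof. by rewrite -addn2; apply: (out_shift chain_1 chain_3). Qed.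

Let next_w_w i : out w i.+1 -> c (vtx i) != c w -> out w i.
Proof. by move=> ow ci; apply: (out_total ow ci (out_before walk_w ow)). Qed.
Let next_w_y i : out w i.+1 -> c (vtx i) != c y -> out y i.
Proof. by move=> ow ci; apply: (out_total ow ci (out_before walk_yw ow)). Qed.
Let next_y_x i : out y i.+1 -> c (vtx i) != c w -> out x i.
Proof.
by rewrite -cxw => oy ci; apply: (out_total oy ci (out_before walk_xy oy)).
Qed.

Let out_rest_y_color z : z \in out_rest y -> c z = c w.
Proof.
move=> /setIdP[zX eyz]; apply/eqP; apply/negPn/negP => cz.
have ezw := to_sink wX sink zX cz.
apply: (@chain_grade [:: x; y; z; w] [:: x; y; w]) => //.
have yz : (y == z) = false by apply/eqP => E; move: eyz; rewrite E arc_irrefl.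
have zw : (z == w) = false by apply/eqP => E; move: ezw; rewrite E arc_irrefl.
have xz : (x == z) = false by apply/eqP => E; move: cz; rewrite -E cxw eqxx.
by rewrite /chain /= evx exy eyz ezw xX yX zX wX !inE xy yw xw yz zw xz.
Qed.

Let out_rest_x_color z : z \in out_rest x -> c z = c y.
Proof.
move=> /setIdP[zX exz]; apply/eqP; apply/negPn/negP => czy.
have czw : c z != c w by rewrite -cxw eq_sym arc_color.
have ezw := to_sink wX sink zX czw.
have xz : (x == z) = false by apply/eqP => E; move: exz; rewrite E arc_irrefl.
have zw : (z == w) = false by apply/eqP => E; move: ezw; rewrite E arc_irrefl.
have yz : (y == z) = false by apply/eqP => E; move: czy; rewrite E eqxx.
case eyz: (e y z).
  have : c z = c w by apply: out_rest_y_color; rewrite inE zX.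
  by move/eqP: czw.
have ezy : e z y by apply: arc_total eyz; rewrite eq_sym.
apply: (@chain_grade [:: x; z; y; w] [:: x; y; w]) => //.
by rewrite /chain /= evx exz ezy eyw xX yX zX wX !inE xy yw xw [z == y]eq_sym yz zw xz.
Qed.

(** Positions that precede an out-neighbour of [w]. *)
Let O1 i := out w i.+1.

Let cnt_O1 : cnt lenR O1 + 1 = alpha.
Proof.
rewrite -(out_sink_pos sink ewv); congr (_ + 1).
by apply: cnt_shift_eq; rewrite ?out0 ?out_lenR.
Qed.

(** Outside the part of [y], these positions are the out-neighbours of [y] on
    [R]. *)
Let cnt_O1_y : cnt lenR (fun i => O1 i && (c (vtx i) == c y)) + 1 = #|out_rest y| + e y v.
Proof.
have := cnt_split lenR O1 (fun i => c (vtx i) == c y).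
have -> : cnt lenR (fun i => O1 i && (c (vtx i) != c y)) = cnt lenR (out y).
  apply: eq_count => i; apply/andP/idP => [[oi ci]|oy]; first exact: next_w_y.
  split; first exact: out_y_w.
  by rewrite eq_sym arc_color //; case/andP: oy.
have := outdeg_split y; have := cnt_O1; arith.
Qed.

(** The out-neighbours of [x] on [R] avoid the part of [w], and two steps after
    each of them there is an out-neighbour of [w]. *)
Let cnt_O2_w : cnt lenR (fun i => out w i.+2 && (c (vtx i) == c w)) < #|out_rest x|.
Proof.
have b : cnt lenR (fun i => out w i.+2 && (c (vtx i) == c w)) + cnt lenR (out x) <=
    cnt lenR (fun i => out w i.+2).
  apply: cnt_disjoint => i; [by case/andP|exact: out_x_w|].
  by case/andP=> _ /eqP E /andP[_ /arc_color]; rewrite E cxw eqxx.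
have : cnt lenR (fun i => out w i.+2) <= cnt lenR O1.
  exact: (@cnt_shift_le _ O1 (out_lenRS w)).
have := outdeg_split x; rewrite (arc_asym evx); have := cnt_O1; arith.
Qed.

Let out_w_vtx0 i : out w i.+1 -> c (vtx i) != c (vtx 0) -> out (vtx 0) i.
Proof.
move=> ow ci; apply: (out_total ow ci).
have [E|NE] := eqVneq (c w) (c (vtx 0)); last exact: (out_before_vtx0 walk_w NE ow).
by apply: (out_before_vtx0 walk_yw) => //; rewrite -E.
Qed.

(** Counting as in [vtx0_part_w], [x] has a single uncovered out-neighbour.  By
    [cnt_O2_w] the out-neighbours of [w] are then isolated on [R], each of them
    preceded by a vertex in the part of [w].  There are [alpha - 1] such vertices
    on [R], besides [x] and [w]: too many for one part. *)
Let vtx0_not_w : c (vtx 0) != c w.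
Proof.
apply/eqP => c0.
pose D' i := O1 i.+1 && (c (vtx i.+1) == c w).
have ED' : cnt lenR D' = cnt lenR (fun i => O1 i && (c (vtx i) == c w)).
  apply: (@cnt_shift_eq _ (fun i => O1 i && (c (vtx i) == c w))).
    apply/andP => -[o1 _]; have := next_w_y o1.
    by rewrite out0 // c0 eq_sym cyw => /(_ isT).
  by rewrite /O1 out_lenRS.
have b1 : cnt lenR D' + cnt lenR (fun i => O1 i && (c (vtx i) != c w)) <=
    cnt lenR (out (vtx 0)).
  apply: cnt_disjoint => i.
  - case/andP=> oi /eqP ci; have oy : out y i.+1.
      by apply: next_w_y; rewrite // ci eq_sym.
    have /andP[lin _] := oy; apply: (out_total oy).
      by rewrite c0 -ci arc_color // vtx_arc.
    by apply: (out_before_vtx0 walk_y _ oy); rewrite c0.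
  - by case/andP=> oi ci; apply: out_w_vtx0; rewrite ?c0.
  - case/andP=> _ /eqP ci /andP[/andP[_ /arc_color]].
    by rewrite ci eqxx.
have b2 := cnt_split lenR O1 (fun i => c (vtx i) == c w).
have b3 : #|out_rest x| <= #|out_rest (vtx 0)|.
  apply: card_out_rest_vtx0; first exact: out_rest_sub.
  by move=> z /out_rest_x_color ->; rewrite c0.
have E0 := outdeg_split (vtx 0).
have no2 i : out w i.+2 -> c (vtx i) != c w.
  move=> o2; apply/negP => ci.
  have lin : i < lenR by case/andP: o2; arith.
  have := cnt_O2_w.
  have := @cnt_gt0 lenR (fun i => out w i.+2 && (c (vtx i) == c w)) i lin.
  by rewrite o2 ci => /(_ isT); have := cnt_O1; arith.
have all_w i : O1 i -> c (vtx i) = c w.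
  elim: i => [//|i IH] oi; apply/eqP; apply/negPn/negP => ci.
  have oi' : O1 i by apply: next_w_w.
  by have := no2 i oi; rewrite IH ?eqxx.
have le1 : cnt lenR O1 <= cnt lenR (fun i => c (vtx i) == c w).
  by apply: cnt_sub => i /all_w ->.
have le2 : cnt lenR (fun i => c (vtx i) == c w) + #|[set x; w]| <= alpha.
  rewrite (cnt_R (fun z => c z == c w)) -(card_part (c w)) -cardsUI.
  have -> : [set z in R | c z == c w] :&: [set x; w] = set0.
    apply/setP => z; rewrite !inE; apply/negP => /andP[/andP[zR _]].
    by case/orP=> /eqP E; [move: xX|move: wX]; rewrite in_rest -E zR.
  rewrite cards0 addn0; apply: subset_leq_card; apply/subsetP => z.
  by rewrite !inE => /orP[/andP[]//|/orP[]/eqP -> //]; rewrite cxw.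
have := cnt_O1; rewrite cards2 xw in le2; arith.
Qed.

(** By [cnt_O1_y] the arcs from [vtx 0] to uncovered vertices and to positions in
    [O1] already number at least [alpha], and one more is found just before the
    first out-neighbour of [w]. *)
Let vtx0_not_y : c (vtx 0) != c y.
Proof.
apply/eqP => c0.
have c0x : c x != c (vtx 0) by rewrite c0 cxw eq_sym.
have ex_o : exists i, O1 i.
  have : 0 < cnt lenR O1 by have := cnt_O1; arith.
  by rewrite -has_count => /hasP[i _ oi]; exists i.
case: (ex_minnP ex_o) => j oj minj.
have cj : c (vtx j) = c w.
  apply/eqP; apply/negPn/negP => cj; have := next_w_w oj cj.
  by case: j oj minj {cj} => [|j] oj minj; rewrite ?out0 // => /minj; rewrite ltnn.
have oyj : out y j by apply: next_w_y; rewrite // cj eq_sym.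
case: j oj minj cj oyj => [|k] oj minj cj oyk; first by rewrite out0 in oyk.
have lin : k.+1 < lenR by case/andP: oyk.
have oxk : out x k by apply: next_y_x; rewrite // -cj arc_color // vtx_arc.
(* position [k] precedes an out-neighbour of [y] and position [k.-1] one of [x];
   one of the two is outside the part of [vtx 0], hence dominated by it *)
have [i lik oi] : exists2 i, i <= k & out (vtx 0) i.
  have [E|NE] := eqVneq (c (vtx k)) (c (vtx 0)); last first.
    exists k => //; apply: (out_total oyk NE).
    exact: (out_before_vtx0 walk_xy c0x).
  case: k {oj minj cj oyk lin} oxk E => [|l] oxl E; first by rewrite out0 in oxl.
  exists l; first by [].
  apply: (out_total oxl); last exact: (out_before_vtx0 walk_x c0x).
  by rewrite -E arc_color // vtx_arc //; case/andP: oxl.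
have b1 : cnt lenR (pred1 i) + cnt lenR (fun i => O1 i && (c (vtx i) != c y)) <=
    cnt lenR (out (vtx 0)).
  apply: cnt_disjoint => l; first by move/eqP->.
    by case/andP=> ol cl; apply: out_w_vtx0; rewrite ?c0.
  by move/eqP-> => /andP[/minj]; arith.
have b2 : 0 < cnt lenR (pred1 i).
  by apply: (@cnt_gt0 _ _ i); rewrite /= ?eqxx //; case/andP: oi.
have b3 : #|x |: out_rest y| <= #|out_rest (vtx 0)|.
  apply: card_out_rest_vtx0; first by rewrite subUset sub1set xX out_rest_sub.
  by move=> z /setU1P[->//|/out_rest_y_color ->]; rewrite c0 eq_sym.
have b4 : #|x |: out_rest y| = #|out_rest y|.+1.
  by rewrite cardsU1 inE (arc_asym exy) andbF.
have b5 := cnt_split lenR O1 (fun i => c (vtx i) == c y).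
have := cnt_O1; have := cnt_O1_y; have := outdeg_split (vtx 0).
by case: (e y v); arith.
Qed.

(** In the remaining part, [vtx 0] dominates the uncovered out-neighbours of [x]
    and [y], the vertex [x], and the positions of [O1] outside its own part.  A
    position of [O1] in this part follows a position counted in [cnt_O1_y] or in
    [cnt_O2_w], so the positions lost are fewer than the uncovered vertices
    gained. *)
Lemma three_step : False.
Proof.
have cover i : c (vtx i) != c (vtx 0) -> (c (vtx i) == c y) || (c (vtx i) == c w).
  have := I3_cover (c (vtx i)) vtx0_not_w vtx0_not_y; rewrite eq_sym cyw => /(_ isT).
  by case: eqP => //= _; rewrite orbC.
pose B i := O1 i && (c (vtx i) == c (vtx 0)).
have EB : cnt lenR (fun i => B i.+1) = cnt lenR B.
  apply: cnt_shift_eq; last by rewrite /B /O1 out_lenRS.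
  apply/andP => -[o1 _]; have := next_w_w o1 vtx0_not_w.
  by rewrite out0.
have b1 : cnt lenR (fun i => B i.+1) <= cnt lenR (fun i => O1 i && (c (vtx i) == c y)) +
    cnt lenR (fun i => out w i.+2 && (c (vtx i) == c w)).
  rewrite (cnt_split _ _ (fun i => c (vtx i) == c y)).
  apply: leq_add; apply: cnt_sub => i.
    case/andP=> /andP[o2 /eqP ci] cy; rewrite cy andbT; apply: next_w_w o2 _.
    by rewrite ci vtx0_not_w.
  case/andP=> /andP[o2 /eqP ci] cy; have /andP[lin _] := o2.
  have /cover : c (vtx i) != c (vtx 0) by rewrite -ci arc_color // vtx_arc // ltnW.
  by rewrite (negbTE cy) /= => ->; rewrite andbT.
have b2 : cnt lenR (fun i => O1 i && (c (vtx i) != c (vtx 0))) <= cnt lenR (out (vtx 0)).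
  by apply: cnt_sub => i /andP[]; apply: out_w_vtx0.
have b3 := cnt_split lenR O1 (fun i => c (vtx i) == c (vtx 0)).
have b4 : #|x |: (out_rest y :|: out_rest x)| <= #|out_rest (vtx 0)|.
  apply: card_out_rest_vtx0; first by rewrite !subUset sub1set xX !out_rest_sub.
  move=> z; rewrite !in_setU in_set1.
  case/or3P=> [/eqP->|/out_rest_y_color->|/out_rest_x_color ->].
  - by rewrite cxw eq_sym vtx0_not_w.
  - by rewrite eq_sym vtx0_not_w.
  - by rewrite eq_sym vtx0_not_y.
have b5 : #|x |: (out_rest y :|: out_rest x)| = (#|out_rest y| + #|out_rest x|).+1.
  rewrite cardsU1 !in_setU ![x \in _]inE arc_irrefl (arc_asym exy) !andbF.
  rewrite cardsU disjoint_setI0 ?cards0 ?subn0 //; apply/pred0P => z /=.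
  apply/negP => /andP[/out_rest_y_color Ey /out_rest_x_color Ex].
  by move: cyw; rewrite -Ex Ey eqxx.
have := cnt_O1; have := cnt_O1_y; have := cnt_O2_w; have := outdeg_split (vtx 0).
by rewrite -/B in b3; rewrite EB in b1; case: (e y v); arith.
Qed.
End ThreeStep.

(** An uncovered out-neighbour [x] of [v] in the part of the sink [w] is not a
    sink, and reaches [w] through a vertex [y] of another part, which is the case
    excluded by [three_step]. *)
Lemma few_lengths_structure : exists x w,
  [/\ x \in rest, w \in rest, e v x, e x w & e w v] /\
  [/\ e v (vtx 0), out_rest w = set0, forall k, has_length k -> k <= lenR.+1
    & forall y, y \in rest -> c y != c x -> e x y].
Proof.
have [x /setIdP[xX evx]] := set0Pn _ out_rest_v_neq0.
have [|w wX sink] := exists_sink; first by apply/set0Pn; exists x.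
have [cxw|cxw] := eqVneq (c x) (c w).
  have [E|] := eqVneq (out_rest x) set0.
    have := @sink_to_v [:: x]; rewrite /chain /= evx xX => /(_ isT E).
    by rewrite (arc_asym evx).
  case/set0Pn => y /setIdP[yX exy].
  have eyw : e y w by apply: to_sink => //; rewrite -cxw eq_sym arc_color.
  have xy : (x == y) = false by apply/eqP => E; move: exy; rewrite E arc_irrefl.
  have yw : (y == w) = false by apply/eqP => E; move: eyw; rewrite E arc_irrefl.
  have xw : (x == w) = false.
    by apply/eqP => E; have := in_set0 y; rewrite -sink inE yX -E exy.
  have ewv : e w v.
    apply: (@sink_to_v [:: x; y; w]) => //.
    by rewrite /chain /= evx exy eyw xX yX wX !inE xy yw xw.
  by have := three_step xX yX wX evx exy eyw ewv sink cxw.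
have exw : e x w by apply: to_sink.
have ewv : e w v.
  have xw : (x == w) = false by apply/eqP => E; move: exw; rewrite E arc_irrefl.
  by apply: (@sink_to_v [:: x; w]) => //; rewrite /chain /= evx exw xX wX mem_seq1 xw.
exists x, w; split=> //.
by have [] := vtx0_part_x xX wX evx exw sink (two_step_vtx0 xX wX evx exw ewv sink).
Qed.

End Few.
End Longest.

Lemma exists_longest : exists2 R, tail_path R
  & forall R', tail_path R' -> size R' <= size R.
Proof.
pose P k := [exists s : k.-tuple V, tail_path s].
have tailP s : tail_path s -> P (size s).
  by move=> ts; apply/existsP; exists (in_tuple s).
have P1 : exists k, P k.
  exists 1; apply: (tailP [:: u]).
  by rewrite /tail_path /= mem_seq1 uv_neq eqxx.
have bound k : P k -> k <= #|V|.
  case/existsP => s /and4P[_ us _ _].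
  by rewrite -(size_tuple s) -(card_uniqP us) max_card.
case: (ex_maxnP P1 bound) => k /existsP[s ts] maxk.
by exists s => // R' /tailP/maxk; rewrite size_tuple.
Qed.

End Arc.
End Tournament.

(** * Reversing the arcs *)

Definition converse (V : Type) (e : rel V) : rel V := fun x y => e y x.

Section Converse.
Variables (V : finType) (e : rel V).

Lemma converse_tour c : tripartite_tournament e c -> tripartite_tournament (converse e) c.
Proof.
case=> ne same diff; split=> // x y cxy; first exact: same.
by rewrite addbC; apply: diff.
Qed.

Lemma converse_reg r : regular_digraph e r -> regular_digraph (converse e) r.
Proof. by move=> reg v; have [o i] := reg v. Qed.

Lemma converse_cycle u v s :
  cycle_through_arc e u v s -> cycle_through_arc (converse e) v u (rev s).
Proof.
case/and3P=> /andP[cs us] su /eqP <-; apply/and3P; split.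
- by rewrite /ucycleb rev_cycle rev_uniq us andbT.
- by rewrite mem_rev mem_next.
- by rewrite next_rev // prev_next.
Qed.

End Converse.

Lemma converse_has_length (V : finType) (e : rel V) u v k :
  has_length (converse e) v u k = has_length e u v k.
Proof.
apply/existsP/existsP => -[s /converse_cycle cs]; exists (rev_tuple s); exact: cs.
Qed.

Lemma converse_lengths (V : finType) (e : rel V) u v :
  arc_cycle_lengths (converse e) v u = arc_cycle_lengths e u v.
Proof. by apply/setP => k; rewrite !inE; apply: converse_has_length. Qed.

(** * At least alpha lengths *)

Section LowerBound.
Variables (V : finType) (e : rel V) (c : V -> 'I_3) (alpha : nat).
Hypothesis tour : tripartite_tournament e c.
Hypothesis reg : regular_digraph e alpha.
Hypothesis card_part : forall i, #|partite_set c i| = alpha.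
Hypothesis alpha_ge2 : 2 <= alpha.

(** The path [S] is the longest cycle [v :: R] without [u], read backwards. *)
Lemma card_arc_cycle_lengths u v : e u v -> alpha <= #|arc_cycle_lengths e u v|.
Proof.
move=> euv; rewrite leqNgt; apply/negP => few.
have tour' := converse_tour tour; have reg' := converse_reg reg.
have evu' : converse e v u by [].
have few' : #|arc_cycle_lengths (converse e) v u| < alpha.
  by rewrite converse_lengths.
have [R tR maxR] := exists_longest tour euv.
have [x [w [[xX wX evx exw ewv] [ev0 sink le_len adj_x]]]] :=
  few_lengths_structure tour reg euv tR maxR card_part alpha_ge2 few.
have [R0 ER] : exists R0, R = rcons R0 u.
  case/and4P: (tR) => _ _ vR /eqP; case/lastP: (R) vR => [_ /= E|R0 z _].
    by have := uv_neq tour euv; rewrite E eqxx.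
  by rewrite last_rcons => ->; exists R0.
pose S := rev (v :: R0).
have szS : size S = size R by rewrite size_rev ER size_rcons.
have tS : tail_path (converse e) v u S.
  case/and4P: (tR) => sR uR vR _; apply/and4P; split.
  - rewrite rev_sorted /=; have : path e v R.
      have := sR; rewrite [X in sorted _ X](R_head tour euv tR) /= => pR.
      by rewrite [X in path _ _ X](R_head tour euv tR) /= ev0.
    by rewrite ER rcons_path => /andP[].
  - rewrite rev_uniq /=; move: uR vR; rewrite ER rcons_uniq mem_rcons inE negb_or.
    by move=> /andP[_ ->] /andP[_ ->].
  - move: uR vR; rewrite mem_rev ER rcons_uniq mem_rcons !inE !negb_or [u == v]eq_sym.
    by move=> /andP[-> _] /andP[-> _].
  - by rewrite /S rev_cons last_rcons.
have maxS S' : tail_path (converse e) v u S' -> size S' <= size S.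
  have [T tT maxT] := exists_longest tour' evu'.
  have [x' [w' [_ [ev0' _ _ _]]]] :=
    few_lengths_structure tour' reg' evu' tT maxT card_part alpha_ge2 few'.
  move/maxT => le; rewrite szS; apply: leq_trans le _.
  have hT : has_length e u v (size T).+1.
    have o0 : out (converse e) v T u 0.
      by rewrite /out ev0' (lenR_gt0 tour' evu' tT).
    have := chord evu' tT (q := [::]) isT o0.
    by rewrite converse_has_length subn0.
  by have := le_len _ hT.
have [x' [w' [[xX' wX' evx' exw' ewv'] [_ sink' _ adj_x']]]] :=
  few_lengths_structure tour' reg' evu' tS maxS card_part alpha_ge2 few'.
have EX : rest u S = rest v R.
  apply/setP => z; rewrite !inE mem_rev ER mem_rcons !inE.
  by case: (z == u); case: (z == v); case: (z \in R0).
rewrite /converse EX in xX' wX' evx' exw' ewv' sink' adj_x'.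
have no_w z : z \in rest v R -> e w z = false.
  by move=> zX; apply/negP => ewz; have := in_set0 z; rewrite -sink inE zX ewz.
have no_w' z : z \in rest v R -> e z w' = false.
  move=> zX; apply/negP => ezw; have := in_set0 z; rewrite -sink' inE EX zX.
  by rewrite /converse ezw.
have cw : c w = c x'.
  by apply/eqP; apply: contraFT (no_w x' xX') => /(adj_x' w wX).
have cw' : c w' = c x.
  by apply/eqP; apply: contraFT (no_w' x xX) => /(adj_x w' wX').
have color a b : e a b -> c a != c b by apply: arc_color tour _ _.
(* [x], [x'], [v] are in different parts, and [u] is in none of them *)
have := @I3_cover (c x) (c x') (c v) (c u).
rewrite -{1}cw (color _ _ exw) [c x == c v]eq_sym (color _ _ evx) -{1}cw (color _ _ ewv).
rewrite -{1}cw' (negbTE (color _ _ ewv')) [c u == c x']eq_sym (negbTE (color _ _ evx')).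
by rewrite (negbTE (color _ _ euv)) => /(_ isT isT isT).
Qed.

End LowerBound.

(** The in- and out-neighbours of a vertex are the [2 * alpha] vertices of the
    other two parts. *)
Lemma regular_degree (V : finType) (e : rel V) c r alpha :
  tripartite_tournament e c -> regular_digraph e r ->
  (forall i, #|partite_set c i| = alpha) -> r = alpha.
Proof.
move=> tour reg card_part.
have cV : #|V| = 3 * alpha.
  rewrite -sum1_card (partition_big c predT) //=.
  rewrite (eq_bigr (fun=> alpha)) => [|i _]; first by rewrite sum_nat_const card_ord.
  by rewrite -(card_part i) -sum1_card; apply: eq_bigl => x; rewrite inE.
have [ne _ _] := tour; have [x _] := set0Pn _ (ne ord0).
have [o i] := reg x.
have : #|[set y | e x y] :|: [set y | e y x]| = r + r.
  rewrite -{1}o -i cardsU disjoint_setI0 ?cards0 ?subn0 //.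
  by apply/pred0P => y /=; rewrite !inE; apply/andP => -[/(arc_asym tour) ->].
have -> : [set y | e x y] :|: [set y | e y x] = ~: partite_set c (c x).
  apply/setP => y; rewrite !inE; apply/orP/idP => [[]/(arc_color tour)|cy].
  - by rewrite eq_sym.
  - by [].
  - by case exy: (e x y); [left|right; apply: (arc_total tour) exy; rewrite eq_sym].
by have := cardsC (partite_set c (c x)); rewrite card_part cV; lia.
Qed.

(** * Sharpness: the blow-up of a directed triangle *)

Section BlowUp.
Variable m : nat.
Let alpha := m.+1.

Definition blow_up : rel ('I_3 * 'I_alpha) := fun x y => y.1 == ordS x.1.

Lemma card_fst (i : 'I_3) : #|[set x : 'I_3 * 'I_alpha | x.1 == i]| = alpha.
Proof.
have -> : [set x : 'I_3 * 'I_alpha | x.1 == i] = setX [set i] setT.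
  by apply/setP => x; rewrite !inE andbT.
by rewrite cardsX cards1 cardsT card_ord mul1n.
Qed.

Lemma blow_up_tour : tripartite_tournament blow_up fst.
Proof.
split.
- by move=> i; rewrite -card_gt0 card_fst.
- by move=> [i a] [j b] /= ->; rewrite /blow_up /=; case: j => [[|[|[|]]] ?].
- by move=> [[[|[|[|i]]] ?] a] [[[|[|[|j]]] ?] b].
Qed.

Lemma blow_up_reg : regular_digraph blow_up alpha.
Proof.
move=> x; split; first exact: card_fst.
rewrite -[RHS](card_fst (ord_pred x.1)); apply: eq_card => y; rewrite !inE /blow_up.
by apply/eqP/eqP => [->|->]; rewrite ?ordSK ?ord_predK.
Qed.

(** Each arc moves to the next part, modulo 3. *)
Lemma blow_up_last x p : path blow_up x p -> (last x p).1 = (x.1 + size p) %% 3 :> nat.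
Proof.
elim: p x => [|y p IH] x /=; first by rewrite addn0 modn_small.
by case/andP=> /eqP E /IH ->; rewrite E /= modnDml addnS addSn.
Qed.

Lemma blow_up_cycle s : s != [::] -> cycle blow_up s -> 3 %| size s.
Proof.
case: s => // x p _ /blow_up_last; rewrite last_rcons size_rcons => E.
have : x.1 + (size p).+1 = x.1 + 0 %[mod 3] by rewrite addn0 -E modn_small.
by move/eqP; rewrite eqn_modDl mod0n.
Qed.

Lemma blow_up_lengths u v : #|arc_cycle_lengths blow_up u v| <= alpha.
Proof.
set A := arc_cycle_lengths _ _ _.
have cV : #|{: 'I_3 * 'I_alpha}| = 3 * alpha by rewrite card_prod !card_ord.
have sub : A \subset [set inord (3 * j.+1) | j : 'I_alpha].
  apply/subsetP => k; rewrite inE => /existsP[s /and3P[/andP[cs _] us _]].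
  have s0 : tval s != [::] by apply: contraTneq us => ->.
  have := blow_up_cycle s0 cs; rewrite size_tuple => /dvdnP[j Ej].
  have j0 : 0 < j by rewrite -size_eq0 size_tuple Ej in s0; case: j s0 {Ej}.
  have kle : k <= 3 * alpha by rewrite -cV -ltnS.
  have jle : j.-1 < alpha by move: kle; rewrite Ej; clear -j0; lia.
  apply/imsetP; exists (Ordinal jle) => //; apply: val_inj => /=.
  by rewrite prednK // mulnC -Ej inordK.
rewrite (leq_trans (subset_leq_card sub)) //.
by rewrite (leq_trans (leq_imset_card _ _)) ?card_ord.
Qed.

End BlowUp.

Theorem theorem1p5 (alpha : nat) (halpha : 2 <= alpha) :
  (forall (V : finType) (e : rel V) (c : V -> 'I_3) (r : nat),
     tripartite_tournament e c ->
     regular_digraph e r ->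
     (forall i : 'I_3, #|partite_set c i| = alpha) ->
     forall u v : V, e u v ->
       exists C : seq (seq V),
         [/\ alpha <= size C,
             (forall s, s \in C -> cycle_through_arc e u v s)
           & uniq [seq size s | s <- C]])
  /\
  (exists (V : finType) (e : rel V) (c : V -> 'I_3),
     [/\ tripartite_tournament e c,
         (exists r : nat, regular_digraph e r),
         (forall i : 'I_3, #|partite_set c i| = alpha)
       & exists u v : V, e u v /\ #|arc_cycle_lengths e u v| = alpha]).
Proof.
split.
  move=> V e c r tour reg card_part u v euv.
  have Er := regular_degree tour reg card_part; rewrite Er in reg.
  have le := card_arc_cycle_lengths tour reg card_part halpha euv.
  pose cyc (k : 'I_#|V|.+1) :=
    if [pick s : k.-tuple V | cycle_through_arc e u v s] is Some s then tval s else [::].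
  have cycP k : k \in arc_cycle_lengths e u v ->
      cycle_through_arc e u v (cyc k) /\ size (cyc k) = k.
    rewrite inE /cyc => /existsP[s cs]; case: pickP => [t ct|/(_ s)]; last by rewrite cs.
    by rewrite size_tuple.
  exists [seq cyc k | k <- enum (arc_cycle_lengths e u v)]; split.
  - by rewrite size_map -cardE.
  - by move=> s /mapP[k]; rewrite mem_enum => /cycP[ck _] ->.
  - rewrite -map_comp (eq_in_map _ val _).1 => [|k].
      by rewrite map_inj_uniq ?enum_uniq //; apply: val_inj.
    by rewrite mem_enum => /cycP[_].
case: alpha halpha => // m halpha.
exists ('I_3 * 'I_m.+1)%type, (@blow_up m), fst; split.
- exact: blow_up_tour.
- by exists m.+1; apply: blow_up_reg.
- exact: card_fst.
exists (ord0, ord0), (ordS ord0, ord0); split; first exact: eqxx.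
apply/eqP; rewrite eqn_leq blow_up_lengths.
apply: (card_arc_cycle_lengths (@blow_up_tour m) (@blow_up_reg m) (@card_fst m) halpha).
exact: eqxx.
Qed.
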